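(* Let $q$ be such that $\pm q$ is a PV number (i.e. $q$ or $-q$ is a PV number). Let $P(X) = L_D X^D + \cdots + c_d X^d \in \mathbb{Z}[X]$ be a non-constant polynomial with $P(q^t) \neq 0$ for all integers $t \geq 1$, where $d \leq D$ and $L_D\, c_d \neq 0$ (so $L_D$ is the leading coefficient, $D$ the degree, and $c_d$ the coefficient of the lowest-degree non-zero term $c_dX^d$). Let $m \geq 1$ and $M \geq 0$ be integers, and let $\alpha_1, \ldots, \alpha_m$ be non-zero algebraic integers in $\mathbb{Q}(q)$ satisfying $$|c_d|^{n_q-1} \, \max\{|\alpha_1|, |\alpha_2|, \ldots, |\alpha_m|\} \, \prod_{l=2}^{n_q} \max\{1, |\sigma_l(\alpha_1)|, |\sigma_l(\alpha_2)|, \ldots, |\sigma_l(\alpha_m)|\} < |q|^{D}.$$ Suppose that $\alpha_{k_1}/\alpha_{k_2}$ is not a root of unity for $1 \leq k_1, k_2 \leq m$ with $k_1 \neq k_2$. Then the numbers in the set $$S := \{ E_{q,P}^{(j)}(\alpha_k) : 1 \leq k \leq m, \ 0 \leq j \leq M \} \cup \{1\}$$ are linearly independent over the field $\mathbb{Q}(q)$.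
   Context: A real algebraic integer $\omega$ is called a Pisot–Vijayraghavan number (PV number) if $\omega > 1$ and all other Galois conjugates $\omega^{(j)}$ of $\omega$ satisfy $|\omega^{(j)}| < 1$ (in particular, integers greater than $1$ are PV numbers). For an algebraic integer $q \neq 0$, $n_q = [\mathbb{Q}(q):\mathbb{Q}]$, and $\sigma_1, \ldots, \sigma_{n_q}$ denote the embeddings of $\mathbb{Q}(q)$ into $\mathbb{C}$, with $\sigma_1$ the identity. Here $|\cdot|$ is the usual complex absolute value. For $q$ with $|q|>1$ and a non-constant polynomial $P(X) \in \mathbb{Z}[X]$ with $P(q^t) \neq 0$ for all integers $t \geq 1$, the generalized $q$-exponential function with respect to $P$ is $$E_{q,P}(x) = 1 + \sum_{n=1}^{\infty} \frac{x^n}{\prod_{t=1}^n P(q^t)}.$$ $E_{q,P}^{(j)}$ denotes its $j$-th derivative with respect to $x$ (with $E_{q,P}^{(0)} = E_{q,P}$). *)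

(* Defs.v *)
From HB Require Import structures.
From mathcomp Require Import all_boot all_order all_algebra all_field.
From mathcomp Require Import complex.
From mathcomp Require Import all_classical all_reals all_analysis.

Set Implicit Arguments.
Unset Strict Implicit.
Unset Printing Implicit Defensive.

Import Order.TTheory GRing.Theory Num.Theory.
Import numFieldNormedType.Exports.

Local Open Scope ring_scope.

Definition algebraic_integer (F : fieldType) (x : F) : Prop :=
  integralOver (intr : int -> F) x.

(* The conjugates of x are the complex roots of its minimal polynomial over Q,
   that is, of the monic irreducible rational polynomial vanishing at x. *)
Definition galois_conjugate (R : realType) (x : R) (z : R[i]) : Prop :=
  exists p : {poly rat},
    [/\ p \is monic, irreducible_poly p,
        root (map_poly ratr p) x & root (map_poly ratr p) z].

(* [Normc.normc] is the R-valued complex modulus, whereas `|z| would be in R[i]. *)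
Definition PV_number (R : realType) (x : R) : Prop :=
  [/\ algebraic_integer x, 1 < x
    & forall z : R[i], galois_conjugate x z -> z != real_complex R x ->
        Normc.normc z < 1].

(* A number field Q(q) with q real is presented as an abstract finite extension
   K of Q together with a field embedding iota : K -> R sending a generator of
   K over Q to q; iota stands for the inclusion of Q(q) in R. *)
Definition presents_Qadjoin (R : realType) (q : R)
    (K : fieldExtType rat) (iota : {rmorphism K -> R}) : Prop :=
  exists2 g : K, iota g = q & <<1; g>>%VS = {:K}%VS.

(* The family sigma lists the embeddings of K into C, each exactly once, the
   first one (index 0) being the inclusion of K in C given by iota. *)
Definition embeddings (R : realType) (K : fieldExtType rat)
    (iota : {rmorphism K -> R})
    (sigma : 'I_(\dim {:K}) -> {rmorphism K -> R[i]}) : Prop :=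
  [/\ forall l1 l2, sigma l1 =1 sigma l2 -> l1 = l2,
      forall tau : {rmorphism K -> R[i]}, exists l, sigma l =1 tau
    & forall l, val l = 0%N ->
        forall x : K, sigma l x = real_complex R (iota x)].

Definition q_exponential (R : realType) (q : R) (P : {poly int}) (x : R) : R :=
  1 + limn (fun N : nat => \sum_(1 <= n < N)
        x ^+ n / \prod_(1 <= t < n.+1) (map_poly intr P).[q ^+ t]).

Definition is_root_of_unity (F : fieldType) (x : F) : Prop :=
  exists2 n : nat, (0 < n)%N & n.-unity_root x.

(* Linear independence, over the subfield iota(K) of R, of an indexed family of
   real numbers (in particular its members are pairwise distinct). *)
Definition linearly_independent (R : realType) (K : fieldType)
    (iota : {rmorphism K -> R}) (I : finType) (v : I -> R) : Prop :=
  forall c : I -> K, \sum_i iota (c i) * v i = 0 -> forall i, c i = 0.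

(* Main.v *)
Require Import Defs.
From HB Require Import structures.
From mathcomp Require Import all_boot all_order all_algebra all_field.
From mathcomp Require Import complex.
From mathcomp Require Import all_classical all_reals all_analysis.
From mathcomp Require Import ring lra.

Set Implicit Arguments.
Unset Strict Implicit.
Unset Printing Implicit Defensive.

Import Order.TTheory GRing.Theory Num.Theory.
Import numFieldNormedType.Exports.

Local Open Scope ring_scope.

(** Write Q_n = P(q) ... P(q^n) and let b_i be the coefficients of a linear
relation, scaled to be algebraic integers of K = Q(q). Since the power series
of E_{q,P} has coefficients 1 / Q_n and may be differentiated term by term, the
relation reads b_None + sum_n u_n / Q_n = 0, where u_n is the value of the
functional G |-> sum_(k, j) b_(k, j) G^(j)(alpha_k) on G = 'X^n. The numerators
A_N = Q_N (b_None + sum_(n <= N) u_n / Q_n) satisfy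
A_(N+1) = P(q^(N+1)) A_N + u_(N+1), so they are algebraic integers of K. The
point is that their norms tend to 0.

In the real place, A_N is minus Q_N times the tail of the convergent series,
whose first term dominates ([remainder_bound]); hence |A_N| is at most about
(max |alpha_k| / |q|^D)^N. In any other place sigma_l the Pisot property gives
|sigma_l q| < 1, so |P(sigma_l(q)^t)| is at most about |c_d| for large t
([horner_power_small]), and the recurrence bounds |sigma_l A_N| by about
(|c_d| max(1, |sigma_l alpha_k|))^N ([perturbed_geometric_bound]). Polynomial
factors and the meaning of about are absorbed in a factor de > 1 as close to 1
as needed. The hypothesis on the alpha_k says exactly that the product of these
rates is less than 1. The norm of A_N being an integer
([prod_embeddings_int]), A_N = 0 for all large N, and then the recurrence gives
u_N = 0 for all large N.

So the functional above vanishes on all multiples of some 'X^N. The alpha_k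
being distinct and non-zero, Hermite interpolation forces all b_(k, j) to vanish
([exponential_polynomial_eq0]), and b_None = 0 follows. *)

(** * Algebraic integers *)

Section AlgebraicIntegers.
Variable F : fieldType.
Implicit Types x y : F.
Let f : {rmorphism int -> F} := intr.

Lemma algebraic_integer_int (z : int) : algebraic_integer (z%:~R : F).
Proof. exact: (integral_id f). Qed.

Lemma algebraic_integer0 : algebraic_integer (0 : F).
Proof. exact: (mxpoly.integral0 f). Qed.

Lemma algebraic_integer1 : algebraic_integer (1 : F).
Proof. exact: (integral1 f). Qed.

Lemma algebraic_integerN x : algebraic_integer x -> algebraic_integer (- x).
Proof. exact: (integral_opp (RtoK := f)). Qed.

Lemma algebraic_integerD x y :
  algebraic_integer x -> algebraic_integer y -> algebraic_integer (x + y).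
Proof. exact: (integral_add (RtoK := f)). Qed.

Lemma algebraic_integerM x y :
  algebraic_integer x -> algebraic_integer y -> algebraic_integer (x * y).
Proof. exact: (integral_mul (RtoK := f)). Qed.

Lemma algebraic_integerX x n : algebraic_integer x -> algebraic_integer (x ^+ n).
Proof.
move=> xi; elim: n => [|n IH]; first by rewrite expr0; exact: algebraic_integer1.
by rewrite exprS; apply: algebraic_integerM.
Qed.

Lemma algebraic_integer_sum (I : finType) (x : I -> F) :
  (forall i, algebraic_integer (x i)) -> algebraic_integer (\sum_i x i).
Proof.
move=> xi; apply: (big_ind (fun y : F => algebraic_integer y)) => //.
- exact: algebraic_integer0.
- exact: algebraic_integerD.
Qed.

Lemma algebraic_integer_prod (I : finType) (P : pred I) (x : I -> F) :
  (forall i, algebraic_integer (x i)) -> algebraic_integer (\prod_(i | P i) x i).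
Proof.
move=> xi; apply: (big_ind (fun y : F => algebraic_integer y)) => //.
- exact: algebraic_integer1.
- exact: algebraic_integerM.
Qed.

Lemma algebraic_integer_horner (p : {poly int}) x :
  algebraic_integer x -> algebraic_integer (map_poly intr p).[x].
Proof.
move=> xi; apply: (integral_horner (RtoK := f)) xi.
by apply/integral_poly => i; rewrite coef_map; exact: (integral_id f).
Qed.
End AlgebraicIntegers.

Lemma algebraic_integer_morph (F L : fieldType) (f : {rmorphism F -> L}) (x : F) :
  algebraic_integer (f x) <-> algebraic_integer x.
Proof.
have E (p : {poly int}) : root (map_poly intr p) (f x) = root (map_poly intr p) x.
  rewrite -(fmorph_root f) -map_poly_comp; congr (root _ _).
  by apply: eq_map_poly => z /=; rewrite rmorph_int.
by split=> -[p pm pr]; exists p => //; move: pr; rewrite E.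
Qed.

(** The ring of integers of Q is Z; the known case of algebraic numbers applies
because the equation has rational coefficients and can be read in any field of
characteristic 0. *)
Lemma ratr_integral_int (F : numFieldType) (r : rat) :
  algebraic_integer (ratr r : F) -> r \is a Num.int.
Proof.
case=> p pm; rewrite rootE => pr.
have pr0 : root (map_poly intr p : {poly rat}) r.
  rewrite rootE -(fmorph_eq0 (ratr : {rmorphism rat -> F})).
  rewrite -horner_map /= -map_poly_comp /=.
  rewrite (eq_map_poly (g := intr)) // => z /=; exact: ratr_int.
have : (ratr r : algC) \in Aint.
  apply: (@root_monic_Aint (map_poly intr p)).
  - rewrite (_ : map_poly intr p = map_poly ratr (map_poly intr p)).
      by rewrite fmorph_root.
    by rewrite -map_poly_comp /=; apply: eq_map_poly => z /=; rewrite ratr_int.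
  - exact: monic_map.
  - by apply/polyOverP => i; rewrite coef_map /=; apply: intr_int.
move=> H; have := Cint_rat_Aint (Crat_rat r) H.
by move/intrP => [z /esym]; rewrite -[z%:~R](@ratr_int algC) => /fmorph_inj <-; apply: intr_int.
Qed.

(** Clearing denominators: if L is the leading coefficient of an integer
polynomial of degree n killing x, then multiplying by L ^ (n - 1) turns the
equation into a monic one for L x. *)
Lemma clear_denominator (K : fieldExtType rat) (x : K) :
  exists2 e : int, e != 0 & algebraic_integer (e%:~R * x).
Proof.
have /polyOver1P[p pE] := minPolyOver 1%AS x.
have p0 : p != 0.
  by apply/eqP => p0; have := monic_minPoly 1%AS x;
     rewrite pE p0 rmorph0 monicE lead_coef0 eq_sym oner_eq0.
have [r [a a0 rE]] := rat_poly_scale p.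
have rx : (map_poly intr r : {poly K}).[x] = 0.
  have := root_minPoly 1%AS x; rewrite pE rE linearZ /= rootE.
  rewrite hornerZ mulf_eq0 -map_poly_comp => /orP[|/eqP].
    by rewrite scaler_eq0 oner_eq0 orbF invr_eq0 intr_eq0 (negbTE a0).
  by rewrite (eq_map_poly (g := intr)) // => z /=; rewrite alg_num_field ratr_int.
have r0 : r != 0 by apply: contra_neq p0 => r0; rewrite rE r0 rmorph0 scaler0.
have [n szr] : {n | size r = n.+2}.
  case: (size r) (size_poly_eq0 r) (@size1_polyC _ r) => [|[|n]].
  - by rewrite (negPf r0).
  - move=> _ /(_ isT) rC; move: rx; rewrite rC map_polyC hornerC /= => /eqP.
    rewrite -(rmorph_int (GRing.in_alg K)) fmorph_eq0 intr_eq0 => /eqP r00.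
    by move: r0; rewrite rC r00 eqxx.
  - by exists n.
pose L := lead_coef r; exists L; first by rewrite lead_coef_eq0.
have LE : r`_n.+1 = L by rewrite /L lead_coefE szr.
pose h : {poly int} := 'X^(n.+1) + \poly_(i < n.+1) (r`_i * L ^+ (n - i)).
exists h.
  by rewrite monicE lead_coefDl ?lead_coefXn // size_polyXn ltnS size_poly.
rewrite rootE; apply/eqP.
have -> : (map_poly intr h).[L%:~R * x] = L%:~R ^+ n * (map_poly intr r).[x].
  rewrite (horner_coef_wide (n := n.+2)); last first.
    apply: leq_trans (size_poly _ _) _.
    rewrite (leq_trans (size_polyD _ _))// geq_max size_polyXn leqnn /=.
    by rewrite (leq_trans (size_poly _ _)).
  rewrite [in RHS](horner_coef_wide (n := n.+2)); last first.
    by rewrite (leq_trans (size_poly _ _)) ?szr.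
  rewrite mulr_sumr big_ord_recr [in RHS]big_ord_recr /=; congr (_ + _).
    apply: eq_bigr => i _; rewrite !coef_map /= coefD coefXn coef_poly ltn_ord.
    have -> : (i == n.+1 :> nat) = false by rewrite ltn_eqF // ltnS ltnW.
    rewrite add0r rmorphM rmorphXn /= exprMn_comm; last exact: mulrC.
    have -> : (L%:~R : K) ^+ n = L%:~R ^+ (n - i) * L%:~R ^+ i.
      by rewrite -exprD subnK // -ltnS.
    by ring.
  rewrite !coef_map /= coefD coefXn eqxx coef_poly ltnn addr0 LE.
  rewrite exprMn_comm; last exact: mulrC.
  by rewrite mul1r [in RHS]mulrA exprSr.
by rewrite rx mulr0.
Qed.

Lemma common_denominator (K : fieldExtType rat) (I : finType) (c : I -> K) :
  exists2 e : K, e != 0 & forall i, algebraic_integer (e * c i).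
Proof.
have /choice[e He] i : exists e : int, e != 0 /\ algebraic_integer (e%:~R * c i).
  by have [e e0 ei] := clear_denominator (c i); exists e.
exists (\prod_i (e i)%:~R).
  apply/prodf_neq0 => i _.
  by rewrite -(rmorph_int (GRing.in_alg K)) fmorph_eq0 intr_eq0; have [] := He i.
move=> i; rewrite (bigD1 i) //= mulrAC; apply: algebraic_integerM.
  by have [] := He i.
by apply: algebraic_integer_prod => j; exact: algebraic_integer_int.
Qed.

(** * The norm of an algebraic integer *)

Section Embeddings.
Variables (F : numFieldType) (K : fieldExtType rat).
Variable sigma : 'I_(\dim {:K}) -> {rmorphism K -> F}.
Hypothesis sigma_inj : forall l1 l2, sigma l1 =1 sigma l2 -> l1 = l2.
Variable g : K.
Hypothesis gK : <<1; g>>%VS = {:K}%VS.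

Lemma rmorph_generator (f1 f2 : {rmorphism K -> F}) : f1 g = f2 g -> f1 =1 f2.
Proof.
move=> fg x; have xg : x \in <<1%AS; g>>%VS by rewrite gK memvf.
rewrite -(Fadjoin_poly_eq xg) -!horner_map fg; congr (_.[_]).
have /polyOver1P[p ->] := Fadjoin_polyOver 1%AS g x.
rewrite -!map_poly_comp; apply: eq_map_poly => a.
by rewrite /= !alg_num_field !fmorph_rat.
Qed.

(** The matrix M of the multiplication by x in a basis b satisfies
W diag(sigma_l x) = M W with W = (sigma_l b_j), and W is invertible because
some rational matrix maps it to the Vandermonde matrix of the distinct numbers
sigma_l g. Taking determinants identifies the product with det M. *)
Lemma prod_embeddings_rat (x : K) :
  exists r : rat, \prod_l sigma l x = ratr r.
Proof.
set n := \dim {:K}.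
pose b (j : 'I_n) := (vbasis {:K})`_j.
pose coor (y : K) (k : 'I_n) := coord (vbasis {:K}) k y.
have coorE y l : sigma l y = \sum_k ratr (coor y k) * sigma l (b k).
  rewrite [in LHS](coord_vbasis (memvf y)) rmorph_sum /=; apply: eq_bigr => k _.
  by rewrite -mulr_algl rmorphM /= alg_num_field fmorph_rat.
pose W : 'M[F]_n := \matrix_(j, l) sigma l (b j).
pose M : 'M[rat]_n := \matrix_(j, k) coor (x * b j) k.
pose T : 'M[rat]_n := \matrix_(j, k) coor (g ^+ j) k.
pose V := Vandermonde n (\row_l sigma l g).
have VE : V = map_mx ratr T *m W.
  apply/matrixP => j l; rewrite !mxE -rmorphXn coorE.
  by apply: eq_bigr => k _; rewrite !mxE.
have V0 : \det V != 0.
  rewrite det_Vandermonde; apply/prodf_neq0 => i _; apply/prodf_neq0 => j ij.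
  rewrite !mxE subr_eq0; apply/eqP => /rmorph_generator /sigma_inj ji.
  by rewrite ji ltnn in ij.
have W0 : \det W != 0.
  by apply: contraNneq V0 => W0; rewrite VE det_mulmx W0 mulr0.
have WE : W *m diag_mx (\row_l sigma l x) = map_mx ratr M *m W.
  apply/matrixP => j l; rewrite mul_mx_diag !mxE -rmorphM mulrC coorE.
  by apply: eq_bigr => k _; rewrite !mxE.
exists (\det M); apply: (mulfI W0).
have := congr1 determinant WE; rewrite !det_mulmx det_diag det_map_mx.
by rewrite (mulrC (ratr _)) => <-; congr (_ * _); apply: eq_bigr => l _; rewrite mxE.
Qed.

(** The product is rational by the previous lemma and an algebraic integer as a product of
conjugates of algebraic integers. *)
Lemma prod_embeddings_int (x : K) : algebraic_integer x ->
  exists z : int, \prod_l sigma l x = z%:~R.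
Proof.
move=> xi; have [r rE] := prod_embeddings_rat x.
suff /intrP[z zE] : r \is a Num.int by exists z; rewrite rE zE ratr_int.
apply: (@ratr_integral_int F); rewrite -rE; apply: algebraic_integer_prod => l.
exact/algebraic_integer_morph.
Qed.
End Embeddings.

(** * Functionals vanishing on large powers *)

(** Each derivation lowers the exponent of ('X - a) by one and, modulo a
multiple of ('X - a), multiplies the cofactor by that exponent. *)
Lemma derivn_root (F : comNzRingType) (a : F) (s j : nat) (H : {poly F}) :
  (j <= s)%N ->
  (('X - a%:P) ^+ s * H)^`(j).[a] = (s`!%:R * H.[a]) *+ (j == s).
Proof.
elim: j s H => [|j IH] [|s] H // js.
- by rewrite derivn0 expr0 fact0 !mul1r eqxx mulr1n.
- by rewrite derivn0 exprS -mulrA hornerM hornerXsubC subrr mul0r.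
have -> : (('X - a%:P) ^+ s.+1 * H)^`(j.+1) =
   (('X - a%:P) ^+ s * (H *+ s.+1 + ('X - a%:P) * H^`()))^`(j).
  rewrite derivSn derivM deriv_exp derivXsubC mul1r /=; congr (_^`(_)).
  by rewrite mulrDr mulrnAl mulrnAr exprSr mulrA.
rewrite IH // eqSS; congr (_ *+ _).
rewrite hornerD hornerMn !hornerE subrr mul0r addr0 factS natrM.
by rewrite -[H.[a] *+ _]mulr_natl mulrA [_ * s.+1%:R]mulrC.
Qed.

(** Applied to a polynomial G in place of 'X^n, the hypothesis says that the
functional G |-> sum_(k, j) c_(k, j) G^(j)(alpha_k) kills every multiple of
'X^N. Testing it on the Hermite-type polynomial that vanishes to order M + 1 at
the other points and to order exactly j at alpha_k isolates c_(k, j), once the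
coefficients of higher order at alpha_k are known to vanish. *)
Lemma exponential_polynomial_eq0 (F : fieldType) (I : finType) (M N : nat)
    (alpha : I -> F) (c : I -> 'I_M.+1 -> F) :
    [pchar F] =i pred0 -> injective alpha -> (forall k, alpha k != 0) ->
    (forall n, (N <= n)%N ->
      \sum_k \sum_j c k j * ('X^n)^`(j).[alpha k] = 0) ->
  forall k j, c k j = 0.
Proof.
move=> F0 ainj a0 cN.
have L0 (G : {poly F}) : \sum_k \sum_j c k j * ('X^N * G)^`(j).[alpha k] = 0.
  have -> : 'X^N * G = \sum_(i < size G) G`_i *: 'X^(N + i).
    rewrite -[in LHS](coefK G) poly_def mulr_sumr.
    by apply: eq_bigr => i _; rewrite -scalerAr exprD.
  transitivity (\sum_(i < size G) G`_i *
     \sum_k \sum_j c k j * ('X^(N + i))^`(j).[alpha k]).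
    under eq_bigr => k _.
      under eq_bigr => j _.
        rewrite linear_sum /= horner_sum mulr_sumr.
        under eq_bigr => i _ do rewrite linearZ hornerZ mulrCA.
        over.
      rewrite exchange_big /=.
      under eq_bigr => i _ do rewrite -mulr_sumr.
      over.
    rewrite exchange_big /=; apply: eq_bigr => i _.
    by rewrite -mulr_sumr.
  by apply: big1 => i _; rewrite cN ?mulr0 // leq_addr.
move=> k.
have step (j : 'I_M.+1) : (forall j' : 'I_M.+1, (j < j')%N -> c k j' = 0) ->
    c k j = 0.
  move=> cj.
  pose H := \prod_(k' | k' != k) ('X - (alpha k')%:P) ^+ M.+1.
  have := L0 (('X - (alpha k)%:P) ^+ j * H).
  rewrite (bigD1 k) //= [X in _ + X]big1 ?addr0; last first.
    move=> k' k'k; apply: big1 => i _.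
    rewrite /H (bigD1 k') //= [_ ^+ M.+1 * _]mulrC mulrA mulrA [_ * _ ^+ _]mulrC.
    rewrite derivn_root; last by rewrite ltnW.
    by rewrite ltn_eqF // mulr0n mulr0.
  rewrite (bigD1 j) //= [X in _ + X]big1 ?addr0; last first.
    move=> i ij; case: (ltngtP i j) => [lt_ij|lt_ji|/val_inj eq_ij].
    - rewrite mulrCA derivn_root; last exact: ltnW.
      by rewrite ltn_eqF // mulr0n mulr0.
    - by rewrite cj // mul0r.
    - by rewrite eq_ij eqxx in ij.
  rewrite mulrCA derivn_root // eqxx mulr1n => /eqP.
  rewrite !mulf_eq0 => /orP[/eqP //|/orP[|]].
    by rewrite ((pcharf0P F).1 F0) eqn0Ngt fact_gt0.
  rewrite hornerM hornerXn mulf_eq0 expf_eq0 (negPf (a0 k)) andbF /=.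
  rewrite /H horner_prod => H0; exfalso; apply/negP: H0.
  apply/prodf_neq0 => k' k'k.
  rewrite horner_exp !hornerE expf_neq0 // subr_eq0.
  by apply: contra k'k => /eqP/ainj ->.
move=> j; have [n] := ubnP (M - j); elim: n j => // n IH j Mj.
apply: step => j' jj'; apply: IH; have := ltn_ord j'.
rewrite !ltnS in Mj * => j'M; apply: leq_trans Mj.
by apply: ltn_sub2l => //; apply: leq_trans j'M.
Qed.

(** * Entire power series *)

Section EntireSeries.
Variable R : realType.
Local Open Scope classical_set_scope.
Implicit Types (a : nat -> R) (x : R).

(** The coefficients of a power series that converges on the whole line; this
form of the condition passes to the derived series by doubling r. *)
Definition entire_coefficients a :=
  forall r : R, 0 < r -> exists C : R, forall n, `|a n| * r ^+ n <= C.

Lemma entire_pseries_cvg a x : entire_coefficients a -> cvgn (pseries a x).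
Proof.
move=> ea; set r := 2%:R * (`|x| + 1).
have x1 : 0 < `|x| + 1 by rewrite ltr_wpDl.
have r0 : 0 < r by rewrite mulr_gt0.
have [C HC] := ea r r0.
have C0 : 0 <= C by apply: le_trans (HC 0%N); rewrite mulr_ge0 // exprn_ge0 // ltW.
apply: normed_cvg.
apply: (@series_le_cvg _ _ (geometric C (2%:R^-1))) => [n|n|n|] /=.
- exact: normr_ge0.
- by rewrite mulr_ge0 // exprn_ge0 // invr_ge0.
- have -> : 2%:R^-1 ^+ n = (`|x| + 1) ^+ n / r ^+ n.
    by rewrite exprMn invfM mulrCA mulfV ?mulr1 ?exprVn // expf_neq0 ?gt_eqF.
  rewrite mulrA ler_pdivlMr ?exprn_gt0 // normrM normrX mulrAC.
  apply: ler_pM; rewrite ?mulr_ge0 ?exprn_ge0 ?(ltW r0) //.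
  by rewrite lerXn2r ?nnegrE ?(ltW x1) // lerDl.
- by apply: is_cvg_geometric_series; rewrite ger0_norm ?invr_ge0 // invf_lt1 // ltr1n.
Qed.

Lemma entire_pseries_diffs a :
  entire_coefficients a -> entire_coefficients (pseries_diffs a).
Proof.
move=> ea r r0; have [|C HC] := ea (2%:R * r); first by rewrite mulr_gt0.
exists (C / r) => n; rewrite ler_pdivlMr // -mulrA -exprSr.
apply: le_trans (HC n.+1); rewrite /pseries_diffs normrM normr_nat exprMn.
rewrite -mulrA [leRHS]mulrCA ler_wpM2r // ?mulr_ge0 ?exprn_ge0 ?(ltW r0) //.
rewrite -natrX ler_nat; exact: ltnW (ltn_expl _ _).
Qed.

Lemma iter_pseries_diffsE a j n :
  iter j (@pseries_diffs R) a n = ((n + j) ^_ j)%:R * a (n + j)%N.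
Proof.
elim: j n => [|j IH] n /=; first by rewrite addn0 ffactn0 mul1r.
rewrite /pseries_diffs IH addSnnS mulrA -natrM ffactnSr.
by rewrite addnS subSn ?leq_addl // addnK mulnC.
Qed.

Lemma derive1n_pseries a j : entire_coefficients a ->
  derive1n j (fun x => limn (pseries a x)) =
  (fun x => limn (pseries (iter j (@pseries_diffs R) a) x)).
Proof.
move=> ea; have eb i : entire_coefficients (iter i (@pseries_diffs R) a).
  by elim: i => //= i; apply: entire_pseries_diffs.
elim: j => [|j IH] //; rewrite derive1nS IH; apply/funext => x.
rewrite derive1E; apply: derive_val.
apply: (@pseries_snd_diffs _ _ (`|x| + 1)).
- by apply: entire_pseries_cvg.
- apply: entire_pseries_cvg; exact: (eb j.+1).
- apply: entire_pseries_cvg; exact: (eb j.+2).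
- by rewrite [ltRHS]ger0_norm ?addr_ge0 // ltrDl.
Qed.

(** The j-th derivative is the sum of the j-th derived series; shifting its index
by j turns its terms into those on the left, whose first j terms vanish. *)
Lemma cvg_derive1n_pseries a j x : entire_coefficients a ->
  (fun N => \sum_(0 <= n < N) a n * ('X^n : {poly R})^`(j).[x]) @ \oo -->
  derive1n j (fun y => limn (pseries a y)) x.
Proof.
move=> ea; rewrite derive1n_pseries //.
have eb i : entire_coefficients (iter i (@pseries_diffs R) a).
  by elim: i => //= i; apply: entire_pseries_diffs.
rewrite -(cvg_shiftn j) /=.
rewrite [X in X @ _](_ : _ = pseries (iter j (@pseries_diffs R) a) x).
  exact: entire_pseries_cvg.
apply/funext => N; rewrite /pseries /series /= addnC (@big_cat_nat _ _ _ j) ?leq_addr //=.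
rewrite [X in X + _]big1_seq ?add0r; last first.
  move=> n /=; rewrite mem_index_iota => /= nj.
  by rewrite derivnXn ffact_small // mulr0n horner0 mulr0.
have := big_addn 0 (j + N) j xpredT (fun i => a i * ('X^i : {poly R})^`(j).[x]).
rewrite add0n addKn => ->; apply: eq_bigr => n _.
rewrite iter_pseries_diffsE derivnXn addnK hornerMn hornerXn.
by rewrite -mulr_natl mulrA [a _ * _]mulrC.
Qed.

End EntireSeries.

(** * Growth of real sequences *)

Section Sequences.
Variable R : realType.
Local Open Scope classical_set_scope.

Lemma expr_small (r e : R) : 0 <= r < 1 -> 0 < e ->
  exists T, forall t, (T <= t)%N -> r ^+ t < e.
Proof.
move=> /andP[r0 r1] e0; have r1' : `|r| < 1 by rewrite ger0_norm.
have /cvgrPdist_lt/(_ e e0)[T _ HT] := cvg_expr r1'.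
exists T => t /HT /=; rewrite sub0r normrN ger0_norm //; exact: exprn_ge0.
Qed.

Lemma expr_large (r B : R) : 1 < r ->
  exists T, forall t, (T <= t)%N -> B <= r ^+ t.
Proof.
move=> r1; have r0 : 0 < r by apply: lt_trans r1.
have B1 : 0 < `|B| + 1 by rewrite ltr_wpDl.
have [||T HT] := @expr_small r^-1 (`|B| + 1)^-1.
- by rewrite invr_ge0 ltW //= invf_lt1.
- by rewrite invr_gt0.
exists T => t /HT; rewrite exprVn ltf_pV2 ?posrE ?exprn_gt0 // => /ltW.
by apply: le_trans; rewrite (le_trans (ler_norm _)) // lerDl.
Qed.

Lemma exists_gt1_mul_expr_lt (x y : R) k : 0 <= x -> x < y ->
  exists2 de : R, 1 < de & x * de ^+ k < y.
Proof.
move=> x0 xy; elim: k => [|k [de de1 H]].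
  by exists 2%:R; rewrite ?ltr1n // expr0 mulr1.
have de0 : 0 < de by apply: lt_trans de1.
set z := x * de ^+ k in H *.
have z0 : 0 <= z by rewrite mulr_ge0 // exprn_ge0 // ltW.
have y0 : 0 < y by apply: le_lt_trans H.
(* Since 0 <= z < y, the second argument exceeds 1 and its product with z is
   still less than y. *)
pose e := Num.min de ((z + 2 * y) / (2 * z + y)).
have dz : 0 < 2 * z + y by lra.
exists e.
  by rewrite lt_min de1 /= ltr_pdivlMr // mul1r; lra.
have e0 : 0 <= e.
  by rewrite le_min (ltW de0) /= divr_ge0 //; lra.
have ze : x * e ^+ k <= z.
  by rewrite ler_wpM2l // lerXn2r ?nnegrE ?(ltW de0) // ge_min lexx.
rewrite exprSr mulrA; apply: le_lt_trans (_ : z * ((z + 2 * y) / (2 * z + y)) < _).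
  by rewrite ler_pM // ?mulr_ge0 ?exprn_ge0 // ge_min lexx orbT.
rewrite mulrA ltr_pdivrMr //; nra.
Qed.

(** Aiming for the rate p b instead of p leaves room p (b - 1) C (p b) ^ N at the
step from N to N + 1, which exceeds the perturbation as soon as C is large. *)
Lemma perturbed_geometric_bound (x : nat -> R) (p b B : R) (N0 : nat) :
  1 <= p -> 1 < b -> (forall N, 0 <= x N) ->
  (forall N, (N0 <= N)%N -> x N.+1 <= p * x N + B * b ^+ N.+1) ->
  exists C, forall N, x N <= C * (p * b) ^+ N.
Proof.
move=> p1 b1 x0 xS.
have p0 : 0 < p by lra.
have b0 : 0 < b by lra.
have w1 : 1 <= p * b by rewrite mulr_ege1 // ltW.
pose C := \sum_(0 <= i < N0.+1) x i + `|B| * b / (b - 1).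
have S0 m : 0 <= \sum_(0 <= i < m) x i by rewrite sumr_ge0.
have T0 : 0 <= `|B| * b / (b - 1) by rewrite divr_ge0 ?mulr_ge0 // ?ltW // subr_gt0.
have C0 : 0 <= C by rewrite addr_ge0.
have CB : `|B| * b <= C * (b - 1).
  by rewrite -ler_pdivrMr ?subr_gt0 // lerDr.
exists C; elim=> [|N IH].
  rewrite expr0 mulr1 /C big_nat_recl // -addrA lerDl addr_ge0 //.
  by rewrite sumr_ge0.
have [NN|NN] := leqP N0 N; last first.
  have xC : x N.+1 <= C.
    rewrite /C (bigD1_seq N.+1) ?iota_uniq ?mem_index_iota //=.
    by rewrite -addrA lerDl addr_ge0 // sumr_ge0.
  by rewrite (le_trans xC) // ler_peMr // exprn_ege1.
apply: le_trans (xS N NN) _.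
have H1 : p * x N <= p * (C * (p * b) ^+ N) by rewrite ler_wpM2l // ltW.
have H2 : B * b ^+ N.+1 <= C * (b - 1) * (p * b) ^+ N.
  apply: (@le_trans _ _ (`|B| * b * b ^+ N)).
    by rewrite exprS mulrA ler_wpM2r ?exprn_ge0 ?(ltW b0) // ler_wpM2r ?(ltW b0) // ler_norm.
  apply: ler_pM => //; rewrite ?mulr_ge0 ?exprn_ge0 ?(ltW b0) //.
  by rewrite lerXn2r ?nnegrE ?mulr_ge0 ?(ltW b0) ?(ltW p0) // ler_peMl // ltW.
apply: le_trans (lerD H1 H2) _; rewrite exprS.
have W0 : 0 <= (p * b) ^+ N by rewrite exprn_ge0 // mulr_ge0 // ltW.
set W := _ ^+ N in W0 *.
have : 0 <= C * W * ((p - 1) * (b - 1)).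
  by rewrite !mulr_ge0 // subr_ge0 // ltW.
by nra.
Qed.

Section Products.
Variable p : nat -> R.
Hypothesis p_neq0 : forall t, (1 <= t)%N -> p t != 0.
Hypothesis p_large : forall B : R, exists T, forall t, (T <= t)%N -> B <= `|p t|.
Local Notation Q n := (\prod_(1 <= t < n.+1) p t).

Lemma partial_prodS n : Q n.+1 = Q n * p n.+1.
Proof. by rewrite big_nat_recr. Qed.

Lemma partial_prod_neq0 n : Q n != 0.
Proof.
by elim: n => [|n IH]; [rewrite big_geq // oner_eq0|rewrite partial_prodS mulf_neq0 // p_neq0].
Qed.

Lemma entire_inv_prod : entire_coefficients (fun n => (Q n)^-1).
Proof.
move=> r r0; have [T HT] := p_large r.
pose y n := `|(Q n)^-1| * r ^+ n.
have y0 n : 0 <= y n by rewrite mulr_ge0 // exprn_ge0 // ltW.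
have yS n : (T <= n)%N -> y n.+1 <= y n.
  move=> Tn; have pn : 0 < `|p n.+1| by rewrite normr_gt0 p_neq0.
  have -> : y n.+1 = y n * (r / `|p n.+1|).
    by rewrite /y partial_prodS !normfV normrM invfM exprSr mulrACA [r / _]mulrC.
  by rewrite ler_piMr // ler_pdivrMr // mul1r HT // leqW.
exists (\sum_(0 <= i < T.+1) y i) => n; rewrite -/(y n); elim: n => [|n IH].
  by rewrite [leRHS]big_nat_recl // lerDl sumr_ge0.
have [Tn|nT] := leqP T n; first exact: le_trans (yS n Tn) IH.
rewrite [leRHS](bigD1_seq n.+1) ?iota_uniq ?mem_index_iota //=.
by rewrite lerDl sumr_ge0.
Qed.

(** The terms u_n / Q_n eventually at least halve, so a partial sum A_N / Q_N
of a series with sum 0 is at most twice the next majorant. *)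
Lemma remainder_bound (A u : nat -> R) (be B : R) :
  0 < be -> (forall n, `|u n| <= B * be ^+ n) ->
  (forall N, A N.+1 = p N.+1 * A N + u N.+1) ->
  A N / Q N @[N --> \oo] --> (0 : R) ->
  exists N0, forall N, (N0 <= N)%N ->
    `|A N| <= 2 * B * be ^+ N.+1 / `|p N.+1|.
Proof.
move=> be0 uB AS A0.
have B0 : 0 <= B by have := le_trans (normr_ge0 _) (uB 0%N); rewrite expr0 mulr1.
have [T HT] := p_large (2 * be).
pose s N := A N / Q N.
pose e n := B * be ^+ n / `|Q n|.
have Q0 n : 0 < `|Q n| by rewrite normr_gt0 partial_prod_neq0.
have p0 n : 0 < `|p n.+1| by rewrite normr_gt0 p_neq0.
have e0 n : 0 <= e n by rewrite divr_ge0 // mulr_ge0 // exprn_ge0 // ltW.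
have eS n : (T <= n)%N -> 2 * e n.+1 <= e n.
  move=> Tn; have -> : 2 * e n.+1 = e n * (2 * be / `|p n.+1|).
    by rewrite /e partial_prodS normrM invfM exprSr; ring.
  by rewrite ler_piMr // ler_pdivrMr // mul1r HT // leqW.
have sS N : s N.+1 = s N + u N.+1 / Q N.+1.
  rewrite /s AS partial_prodS; field.
  by rewrite p_neq0 // partial_prod_neq0.
have us N : `|u N.+1 / Q N.+1| <= e N.+1.
  by rewrite normrM normfV ler_wpM2r // invr_ge0.
exists T => N TN.
have mono k : `|s N| - 2 * e N.+1 <= `|s (N + k)%N| - 2 * e (N + k).+1.
  elim: k => [|k IH]; first by rewrite addn0.
  apply: le_trans IH _; rewrite addnS.
  set m := (N + k)%N.
  have H1 : `|s m| <= `|s m.+1| + e m.+1.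
    have -> : s m = s m.+1 - u m.+1 / Q m.+1 by rewrite sS addrK.
    by rewrite (le_trans (ler_normB _ _)) // lerD2l.
  have H2 : 2 * e m.+2 <= e m.+1.
    by rewrite eS // leqW // (leq_trans TN) // leq_addr.
  by lra.
have sN : `|s N| <= 2 * e N.+1.
  apply/ler_addgt0Pr => eps eps0.
  have /cvgrPdist_lt/(_ eps eps0)[N1 _ HN1] := A0.
  have := HN1 (N + N1)%N (leq_addl _ _); rewrite /= sub0r normrN => /ltW.
  by have := mono N1; have := e0 (N + N1).+1; rewrite -/(s _); lra.
have -> : A N = s N * Q N by rewrite /s divfK ?partial_prod_neq0.
rewrite normrM; apply: le_trans (ler_wpM2r (ltW (Q0 N)) sN) _.
rewrite /e partial_prodS normrM le_eqVlt; apply/orP; left; apply/eqP; field.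
by rewrite !lt0r_neq0.
Qed.
End Products.
End Sequences.

(** * Complex moduli and polynomial values *)

Section Modulus.
Variable R : realType.
Local Notation normc := (@Normc.normc R).

Lemma normc_real (x : R) : normc (real_complex R x) = `|x|.
Proof. by rewrite /= expr0n /= addr0 sqrtr_sqr. Qed.

Lemma normc_ge0 z : 0 <= normc z.
Proof. by case: z => a b /=; apply: sqrtr_ge0. Qed.

Lemma normcX z n : normc (z ^+ n) = normc z ^+ n.
Proof.
by elim: n => [|n IH]; rewrite ?expr0 ?Normc.normc1 // !exprS Normc.normcM IH.
Qed.

Lemma normc_int (z : int) : normc z%:~R = `|z|%:~R.
Proof. by rewrite -(rmorph_int (real_complex R)) normc_real intr_norm. Qed.

Lemma normc_prod (I : finType) (F : I -> R[i]) :
  normc (\prod_i F i) = \prod_i normc (F i).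
Proof. by apply: big_morph; [exact: Normc.normcM|exact: Normc.normc1]. Qed.

Lemma ler_normc_sum (I : eqType) (r : seq I) (F : I -> R[i]) :
  normc (\sum_(i <- r) F i) <= \sum_(i <- r) normc (F i).
Proof.
elim: r => [|i r IH]; first by rewrite !big_nil Normc.normc0.
by rewrite !big_cons (le_trans (le_normcD _ _)) // lerD2l.
Qed.

(** As w = z ^ t tends to 0, the term of lowest degree dominates, and it is at
most |P`_d| in modulus. *)
Lemma horner_power_small (P : {poly int}) (d D : nat) (z : R[i]) (de : R) :
  P = \sum_(d <= i < D.+1) P`_i *: 'X^i -> (d <= D)%N -> P`_d != 0 ->
  normc z < 1 -> 1 < de ->
  exists T, forall t, (T <= t)%N ->
    normc (map_poly intr P).[z ^+ t] <= de * `|P`_d|%:~R.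
Proof.
move=> PE dD Pd z1 de1.
pose S : R := \sum_(d.+1 <= i < D.+1) `|P`_i|%:~R.
have S0 : 0 <= S by apply: sumr_ge0 => i _; rewrite ler0z.
have S1 : 0 < S + 1 by rewrite ltr_wpDl.
have d1 : 1 <= `|P`_d|%:~R :> R.
  by rewrite -[1]/(1%:~R) ler_int -gtz0_ge1 normr_gt0.
have [||T HT] := @expr_small R (normc z) ((de - 1) / (S + 1)).
- by rewrite normc_ge0.
- by rewrite divr_gt0 ?subr_gt0.
exists T.+1 => t Tt; set w := z ^+ t.
have wE : normc w = normc z ^+ t by rewrite normcX.
have w0 : 0 <= normc w := normc_ge0 w.
have w1 : normc w <= 1 by rewrite wE exprn_ile1 ?normc_ge0 // ltW.
have wS : normc w * S <= de - 1.
  have := HT t (ltnW Tt); rewrite -wE ltr_pdivlMr // => /ltW.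
  by apply: le_trans; rewrite ler_wpM2l // lerDl.
rewrite [in leLHS]PE rmorph_sum horner_sum /=.
apply: le_trans (ler_normc_sum _ _) _.
rewrite (eq_bigr (fun i => `|P`_i|%:~R * normc w ^+ i)); last first.
  move=> i _; rewrite linearZ /= map_polyXn hornerZ hornerXn Normc.normcM.
  by rewrite normc_int normcX.
rewrite big_ltn ?ltnS //.
have H1 : `|P`_d|%:~R * normc w ^+ d <= `|P`_d|%:~R :> R.
  by rewrite ler_piMr ?ler0z // exprn_ile1.
have H2 : \sum_(d.+1 <= i < D.+1) `|P`_i|%:~R * normc w ^+ i <= normc w * S.
  rewrite mulr_sumr ; apply: ler_sum_nat => i /andP[di _].
  rewrite mulrC ler_wpM2r ?ler0z //.
  by case: i di => // i _; rewrite exprS ler_piMr // exprn_ile1.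
apply: le_trans (lerD H1 (le_trans H2 wS)) _.
set c := `|P`_d|%:~R in d1 *.
have : 0 <= (de - 1) * (c - 1) by rewrite mulr_ge0 // subr_ge0 // ltW.
by lra.
Qed.

(** The constant c is half the modulus of the leading coefficient, which leaves the other
half to absorb the terms of lower degree. *)
Lemma horner_large (p : {poly R}) (D : nat) : size p = D.+2 ->
  exists2 c, 0 < c & exists Y, forall y, Y <= `|y| -> c * `|y| ^+ D.+1 <= `|p.[y]|.
Proof.
move=> sp; set L := lead_coef p.
have L0 : 0 < `|L| by rewrite normr_gt0 lead_coef_eq0 -size_poly_eq0 sp.
pose S := \sum_(i < D.+1) `|p`_i|.
have S0 : 0 <= S by apply: sumr_ge0.
exists (`|L| / 2); first by rewrite divr_gt0.
exists (Num.max 1 (2 * S / `|L|)) => y; rewrite ge_max => /andP[y1].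
rewrite ler_pdivrMr // => yS.
have H : `|\sum_(i < D.+1) p`_i * y ^+ i| <= S * `|y| ^+ D.
  rewrite (le_trans (ler_norm_sum _ _ _)) // mulr_suml ler_sum // => i _.
  by rewrite normrM normrX ler_wpM2l // ler_weXn2l // -ltnS.
rewrite horner_coef sp big_ord_recr /=.
have -> : p`_D.+1 = L by rewrite /L lead_coefE sp.
rewrite addrC; set s := \sum_(i < _) _ in H *.
have := lerB_normD (L * y ^+ D.+1) s.
rewrite normrM normrX; apply: le_trans.
have H2 : 2 * S * `|y| ^+ D <= `|y| * `|L| * `|y| ^+ D by rewrite ler_wpM2r ?exprn_ge0.
by rewrite exprS; lra.
Qed.

Definition geometric_bound (v : nat -> R[i]) (w : R) :=
  exists B, forall n, normc (v n) <= B * w ^+ n.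

Lemma geometric_bound_sum (I : finType) (v : I -> nat -> R[i]) w :
  (forall i, geometric_bound (v i) w) ->
  geometric_bound (fun n => \sum_i v i n) w.
Proof.
move=> /choice[B HB]; exists (\sum_i B i) => n.
by rewrite (le_trans (ler_normc_sum _ _)) // mulr_suml ler_sum.
Qed.

(** The binomial expansion of de ^ n = (1 + h) ^ n contains the term
'C(n, j) h ^ j, which is a multiple of n ^_ j. *)
Lemma ffact_geometric (de : R) (j : nat) : 1 < de ->
  exists2 B, 0 <= B & forall n, (n ^_ j)%:R <= B * de ^+ n.
Proof.
move=> de1; set h := de - 1.
have h0 : 0 < h by rewrite subr_gt0.
have deE : de = h + 1 by rewrite subrK.
have de0 : 0 < de by lra.
exists (j`!%:R / h ^+ j); first by rewrite divr_ge0 // exprn_ge0 // ltW.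
move=> n; have [nj|jn] := ltnP n j.
  by rewrite ffact_small // mulr_ge0 ?divr_ge0 ?exprn_ge0 ?ltW.
rewrite mulrAC ler_pdivlMr ?exprn_gt0 // -bin_ffact natrM mulrAC mulrC.
rewrite ler_wpM2l // [in leRHS]deE addrC [in leRHS]exprDn.
have jn' : (j < n.+1)%N by [].
rewrite (bigD1 (Ordinal jn')) //= expr1n mul1r mulr_natl lerDl.
by apply: sumr_ge0 => i _; rewrite mulrn_wge0 // mulr_ge0 ?exprn_ge0 // ?ltW.
Qed.

Lemma derivn_geometric_bound (c a : R[i]) (j : nat) (be de : R) :
  a != 0 -> normc a <= be -> 1 < de ->
  geometric_bound (fun n => c * ('X^n : {poly R[i]})^`(j).[a]) (de * be).
Proof.
move=> a0 abe de1; have [B B0 HB] := ffact_geometric j de1.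
have na0 : 0 < normc a.
  by rewrite lt_def normc_ge0 andbT; apply: contra_neq a0; apply: Normc.eq0_normc.
exists (normc c * (B / normc a ^+ j)) => n.
rewrite Normc.normcM -mulrA ler_wpM2l ?normc_ge0 //.
rewrite derivnXn hornerMn hornerXn normcMn normcX -mulr_natl.
have de0 : 0 < de by lra.
have be0 : 0 < be by apply: lt_le_trans abe.
have [nj|jn] := ltnP n j.
  rewrite ffact_small // mul0r mulr_ge0 ?divr_ge0 ?exprn_ge0 ?mulr_ge0 //; exact: ltW.
rewrite mulrAC ler_pdivlMr ?exprn_gt0 // -mulrA -exprD subnK //.
rewrite exprMn mulrA ler_pM ?exprn_ge0 ?normc_ge0 //.
by rewrite lerXn2r ?nnegrE ?normc_ge0 // ltW.
Qed.
End Modulus.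

(** * Conjugates of a Pisot number *)

Section Conjugates.
Variables (R : realType) (K : fieldExtType rat).
Variables (iota : {rmorphism K -> R}) (tau : {rmorphism K -> R[i]}).

(** The minimal polynomial of h over Q witnesses the conjugacy, since every
morphism from K to a field of characteristic 0 is Q-linear. *)
Lemma conjugate_embedding (h : K) : galois_conjugate (iota h) (tau h).
Proof.
have /polyOver1P[p pE] := minPolyOver 1%AS h.
have root_image (L : numFieldType) (f : {rmorphism K -> L}) : root (map_poly ratr p) (f h).
  have := root_minPoly 1%AS h; rewrite -(fmorph_root f) pE -map_poly_comp.
  by rewrite (eq_map_poly (g := ratr)) // => a /=; rewrite alg_num_field fmorph_rat.
exists p; split => //.
- by have := monic_minPoly 1%AS h; rewrite pE map_monic.
- split.
    have : (1 < size (minPoly 1%AS h))%N by rewrite size_minPoly.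
    by rewrite pE size_map_poly.
  move=> r r1 rp.
  have : map_poly (GRing.in_alg K) r %| minPoly 1%AS h by rewrite pE dvdp_map.
  move=> /(minPoly_irr _) -/(_ _)/orP[].
  - by apply/polyOver1P; exists r.
  - by rewrite pE eqp_map.
  - rewrite -(rmorph1 (map_poly (GRing.in_alg K))) eqp_map => /eqp_size.
    by rewrite size_poly1 => /eqP; rewrite (negPf r1).
- exact: root_image.
- exact: root_image.
Qed.

Lemma PV_conjugate_lt1 (g : K) :
  PV_number (iota g) \/ PV_number (- iota g) ->
  tau g != real_complex R (iota g) -> Normc.normc (tau g) < 1.
Proof.
move=> [[_ _ H]|[_ _ H]] tg; first exact: H (conjugate_embedding g) tg.
rewrite -rmorphN in H; rewrite -normcN -rmorphN.
apply: H (conjugate_embedding (- g)) _.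
by rewrite !rmorphN eqr_opp.
Qed.
End Conjugates.

(** * The series of the q-exponential function *)

Section QExponential.
Variable R : realType.
Local Open Scope classical_set_scope.

(** The 1 in front of the series is its term of index 0. *)
Lemma q_exponentialE (q : R) (P : {poly int}) (x : R) :
  let a := fun n => (\prod_(1 <= t < n.+1) (map_poly intr P).[q ^+ t])^-1 in
  entire_coefficients a ->
  q_exponential q P x = limn (pseries a x).
Proof.
move=> a ea; rewrite /q_exponential; set s := fun N : nat => _.
have sE N : pseries a x N.+1 = 1 + s N.+1.
  rewrite /pseries /series /= big_ltn //.
  rewrite /a big_geq // invr1 expr0 mulr1; congr (_ + _).
  by apply: eq_bigr => n _; rewrite mulrC.
have := @entire_pseries_cvg _ a x ea; rewrite -cvg_shiftS /= => Hc.
have Hs : s N @[N --> \oo] --> limn (pseries a x) - 1.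
  rewrite -cvg_shiftS /=.
  rewrite [X in X @ _](_ : _ = (fun N => pseries a x N.+1 - 1)); last first.
    by apply/funext => N; rewrite sE addrC addKr.
  by apply: cvgB => //; exact: cvg_cst.
by rewrite (cvg_lim _ Hs) // addrC subrK.
Qed.

End QExponential.

Lemma cvg_sum (R : realType) (I : finType) (f : I -> nat -> R) (l : I -> R) :
  (forall i, (f i n @[n --> \oo] --> l i)%classic) ->
  ((\sum_i f i n) @[n --> \oo] --> \sum_i l i)%classic.
Proof.
move=> fl; apply: cvg_big => [|i _]; [exact: add_continuous|exact: fl].
Qed.

(** * Integrality against smallness *)

Section IntegerNorms.
Variable R : realType.

(** The product of the moduli over all embeddings is the modulus of an integer,
so once it drops below 1 it must be 0. *)
Lemma integer_norm_eventually0 (K : fieldExtType rat)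
    (sigma : 'I_(\dim {:K}) -> {rmorphism K -> R[i]}) (g : K)
    (A : nat -> K) (w : 'I_(\dim {:K}) -> R) :
  (forall l1 l2, sigma l1 =1 sigma l2 -> l1 = l2) ->
  <<1; g>>%VS = {:K}%VS ->
  (forall N, algebraic_integer (A N)) ->
  (forall l, 0 <= w l) -> \prod_l w l < 1 ->
  (forall l, exists C N0, forall N, (N0 <= N)%N ->
     Normc.normc (sigma l (A N)) <= C * w l ^+ N) ->
  exists N1, forall N, (N1 <= N)%N -> A N = 0.
Proof.
move=> sinj gK Ai w0 w1 /choice[C /choice[N0 HN0]].
pose C' := \prod_l `|C l|.
have C'0 : 0 <= C' by apply: prodr_ge0.
have [||T HT] := @expr_small R (\prod_l w l) (C' + 1)^-1.
- by rewrite prodr_ge0.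
- by rewrite invr_gt0 ltr_wpDl.
exists (maxn T (\max_l N0 l)) => N; rewrite geq_max => /andP[TN MN].
have [z zE] := prod_embeddings_int sinj gK (Ai N).
have zlt : `|z|%:~R < 1 :> R.
  rewrite -normc_int -zE normc_prod.
  apply: le_lt_trans (_ : C' * (\prod_l w l) ^+ N < 1).
    rewrite -prodrXl -big_split /=; apply: ler_prod => l _.
    rewrite normc_ge0 /=; apply: le_trans (HN0 l N _) _.
      by apply: leq_trans MN; exact: (@leq_bigmax _ N0).
    by rewrite ler_wpM2r ?exprn_ge0 // ler_norm.
  have C1 : 0 < C' + 1 by rewrite ltr_wpDl.
  have := HT N TN; rewrite -[_^-1]mul1r ltr_pdivlMr // => H.
  apply: le_lt_trans H; rewrite mulrC ler_wpM2l ?exprn_ge0 ?prodr_ge0 //.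
  by rewrite lerDl.
have z0 : z = 0.
  apply/eqP; rewrite -normr_le0; move: zlt; rewrite -[1]/(1%:~R) ltr_int.
  by case: (`|z|) (normr_ge0 z) => // -[].
have : \prod_l sigma l (A N) == 0 by rewrite zE z0.
by move=> /prodf_eq0[l _]; rewrite fmorph_eq0 => /eqP.
Qed.

End IntegerNorms.

(** * Linear independence *)

Theorem theorem1p1 (R : realType) (q : R)
  (hq : PV_number q \/ PV_number (- q))
  (K : fieldExtType rat) (iota : {rmorphism K -> R})
  (hK : presents_Qadjoin q iota)
  (sigma : 'I_(\dim {:K}) -> {rmorphism K -> R[i]})
  (hsigma : embeddings iota sigma)
  (P : {poly int}) (d D : nat)
  (hP : P = \sum_(d <= i < D.+1) P`_i *: 'X^i)
  (hdD : (d <= D)%N)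
  (hLc : P`_D * P`_d != 0)
  (hPnonconst : (1 < size P)%N)
  (hPq : forall t : nat, (1 <= t)%N ->
    (map_poly (intr : int -> R) P).[q ^+ t] != 0)
  (m M : nat) (hm : (1 <= m)%N)
  (alpha : 'I_m -> K)
  (halpha0 : forall k, alpha k != 0)
  (halpha : forall k, algebraic_integer (alpha k))
  (hineq :
    (`|P`_d|%:~R : R) ^+ (\dim {:K} - 1)
    * \big[Num.max/0]_(k < m) `|iota (alpha k)|
    * \prod_(l < \dim {:K} | (0 < l)%N)
        \big[Num.max/1]_(k < m) Normc.normc (sigma l (alpha k))
    < `|q| ^+ D)
  (hunity : forall k1 k2 : 'I_m, k1 != k2 ->
    ~ is_root_of_unity (alpha k1 / alpha k2)) :
  linearly_independent iota
    (fun i : option ('I_m * 'I_M.+1) =>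
       if i is Some (k, j)
       then derive1n j (q_exponential q P) (iota (alpha k))
       else 1).
Proof.
case: hK => g gq gK; case: hsigma => sinj _ s0.
have [Dnz cdnz] : P`_D != 0 /\ P`_d != 0 by apply/andP; move: hLc; rewrite mulf_eq0 negb_or.
have szP : size P = D.+1.
  apply/eqP; rewrite eqn_leq; apply/andP; split.
    apply/leq_sizeP => i Di; rewrite hP coef_sum big1_seq // => r.
    rewrite mem_index_iota => /andP[_ /andP[_ rD]].
    by rewrite coefZ coefXn gtn_eqF ?mulr0 // (leq_trans rD).
  by rewrite ltnNge; apply: contra Dnz => /leq_sizeP ->.
have [D' DE] : exists D', D = D'.+1.
  by case: (D) szP hPnonconst => [|D'] ->; [|exists D'].
have q1 : 1 < `|q|.
  by case: hq => -[_ q1 _]; [rewrite ger0_norm ?(ltW (lt_trans ltr01 q1))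
                            |rewrite -normrN ger0_norm ?(ltW (lt_trans ltr01 q1))].
have gi : algebraic_integer g.
  apply/(algebraic_integer_morph iota); rewrite gq.
  by case: hq => -[qi _ _] //; rewrite -[q]opprK; apply: algebraic_integerN.
pose p t := (map_poly intr P : {poly R}).[q ^+ t].
have pE t : iota (map_poly intr P).[g ^+ t] = p t.
  rewrite -horner_map rmorphXn /= gq -map_poly_comp /p; congr (_.[_]).
  by apply: eq_map_poly => z /=; rewrite rmorph_int.
have [c0 c00 [Y HY]] : exists2 c, 0 < c & exists Y, forall y : R, Y <= `|y| ->
    c * `|y| ^+ D <= `|(map_poly intr P).[y]|.
  rewrite DE; apply: horner_large.
  by rewrite size_map_inj_poly ?szP ?DE //; exact: intr_inj.
have p_lower : exists T, forall t, (T <= t)%N -> c0 * `|q| ^+ t ^+ D <= `|p t|.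
  have [T HT] := expr_large Y q1.
  by exists T => t Tt; rewrite -normrX HY // normrX HT.
have p_large (B : R) : exists T, forall t, (T <= t)%N -> B <= `|p t|.
  have [T HT] := p_lower; have [T' HT'] := expr_large (B / c0) q1.
  exists (maxn T T') => t; rewrite geq_max => /andP[Tt Tt'].
  apply: le_trans (HT t Tt); rewrite mulrC -ler_pdivrMr //.
  apply: le_trans (HT' t Tt') _; rewrite DE -[leLHS]expr1.
  by rewrite ler_weXn2l // exprn_ege1 // ltW.
have aE := entire_inv_prod hPq p_large.
have Qn0 := partial_prod_neq0 hPq.
move=> c rel.
have [e e0 He] := common_denominator c.
pose b i := e * c i.
have bi i : algebraic_integer (b i) := He i.
suff b0 i : b i = 0.
  by move=> i; apply/eqP; have /eqP := b0 i; rewrite mulf_eq0 (negPf e0).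
pose bk k j := b (Some (k, j)).
have brel : iota (b None) + \sum_k \sum_j iota (bk k j) *
    derive1n j (q_exponential q P) (iota (alpha k)) = 0.
  transitivity (iota e * 0); last exact: mulr0.
  rewrite -[in RHS]rel mulr_sumr [RHS](bigD1 None) //= mulr1 /b rmorphM; congr (_ + _).
  rewrite (reindex_omap Some id) /=; last by case.
  rewrite pair_bigA; apply: eq_big => [[k j]|[k j] _] /=; first by rewrite eqxx.
  by rewrite mulrA -rmorphM.
pose u n := \sum_k \sum_j bk k j * ('X^n : {poly K})^`(j).[alpha k].
(* A N is Q_N times the N-th partial sum of the relation. *)
pose A := nat_rect (fun _ => K) (b None + u 0%N)
  (fun N a => (map_poly intr P).[g ^+ N.+1] * a + u N.+1).
have AS N : A N.+1 = (map_poly intr P).[g ^+ N.+1] * A N + u N.+1 by [].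
have ui n : algebraic_integer (u n).
  apply: algebraic_integer_sum => k; apply: algebraic_integer_sum => j.
  apply: algebraic_integerM; first exact: bi.
  rewrite derivnXn hornerMn hornerXn -mulr_natr -[_%:R]/((Posz (n ^_ j))%:~R).
  apply: algebraic_integerM; last exact: algebraic_integer_int.
  exact: algebraic_integerX.
have Ai N : algebraic_integer (A N).
  elim: N => [|N IH]; first exact: algebraic_integerD (bi None) (ui 0%N).
  rewrite AS; apply: algebraic_integerD (ui _); apply: algebraic_integerM IH.
  by apply: algebraic_integer_horner; apply: algebraic_integerX.
have iAS N : iota (A N.+1) = p N.+1 * iota (A N) + iota (u N.+1).
  by rewrite AS rmorphD rmorphM pE.
pose Q n := \prod_(1 <= t < n.+1) p t.
have AQ N : iota (A N) / Q N = iota (b None) +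
    \sum_k \sum_j iota (bk k j) *
      \sum_(0 <= n < N.+1) (Q n)^-1 * ('X^n : {poly R})^`(j).[iota (alpha k)].
  have -> : \sum_k \sum_j iota (bk k j) *
      \sum_(0 <= n < N.+1) (Q n)^-1 * ('X^n : {poly R})^`(j).[iota (alpha k)]
      = \sum_(0 <= n < N.+1) iota (u n) / Q n.
    under eq_bigr => k _.
      under eq_bigr => j _ do rewrite mulr_sumr.
      rewrite exchange_big /=.
      over.
    rewrite exchange_big /=; apply: eq_bigr => n _.
    rewrite rmorph_sum mulr_suml; apply: eq_bigr => k _.
    rewrite rmorph_sum mulr_suml; apply: eq_bigr => j _.
    rewrite rmorphM -horner_map -derivn_map map_polyXn.
    by rewrite mulrA mulrAC.
  elim: N => [|N IH].
    by rewrite big_nat1 /Q big_geq // !divr1 rmorphD.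
  rewrite big_nat_recr //= addrA -IH iAS /Q partial_prodS; field.
  by rewrite Qn0 hPq.
have A_cvg : (iota (A N) / Q N @[N --> \oo] --> (0 : R))%classic.
  rewrite [X in (X @ _)%classic](funext AQ) -[X in (_ --> X)%classic]brel.
  apply: cvgD; first exact: cvg_cst.
  apply: cvg_sum => k; apply: cvg_sum => j; apply: cvgMr.
  have /= := @cvg_derive1n_pseries _ _ j (iota (alpha k)) aE.
  rewrite -cvg_shiftS /=.
  rewrite (_ : (fun y => limn (pseries _ y)) = q_exponential q P) //.
  by apply/funext => y; rewrite q_exponentialE.
have u_bound l be de : (forall k, Normc.normc (sigma l (alpha k)) <= be) -> 1 < de ->
    geometric_bound (fun n => sigma l (u n)) (de * be).
  move=> abe de1.
  rewrite (_ : (fun n => _) = fun n => \sum_k \sum_j sigma l (bk k j) *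
      ('X^n : {poly R[i]})^`(j).[sigma l (alpha k)]); last first.
    apply/funext => n; rewrite rmorph_sum; apply: eq_bigr => k _.
    rewrite rmorph_sum; apply: eq_bigr => j _.
    by rewrite rmorphM -horner_map -derivn_map map_polyXn.
  apply: geometric_bound_sum => k; apply: geometric_bound_sum => j.
  by apply: derivn_geometric_bound; rewrite ?fmorph_eq0.
pose i0 : 'I_(\dim {:K}) := Ordinal (adim_gt0 {:K}%AS).
pose al := \big[Num.max/0]_(k < m) `|iota (alpha k)|.
pose be l := \big[Num.max/1]_(k < m) Normc.normc (sigma l (alpha k)).
pose cd : R := `|P`_d|%:~R.
have al_gt0 : 0 < al.
  apply: (@lt_le_trans _ _ `|iota (alpha (Ordinal hm))|).
    by rewrite normr_gt0 fmorph_eq0.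
  exact: (le_bigmax 0 (fun k => `|iota (alpha k)|)).
have be_ge1 l : 1 <= be l by exact: bigmax_ge_id.
have cd_ge1 : 1 <= cd by rewrite -[1]/(1%:~R) ler_int -gtz0_ge1 normr_gt0.
have qD_gt0 : 0 < `|q| ^+ D by rewrite exprn_gt0 // (lt_trans ltr01).
have i0E (l : 'I_(\dim {:K})) : (0 < l)%N = (l != i0) by rewrite lt0n.
have sigma0 x : Normc.normc (sigma i0 x) = `|iota x| by rewrite s0 // normc_real.
(* Each place other than the real one costs two factors de, one for
P(sigma_l(q)^t) and one for u_n; the real place costs one, for u_n. *)
have [de de1 hde] : exists2 de : R, 1 < de &
    cd ^+ (\dim {:K} - 1) * al * \prod_(l | l != i0) be l
      * de ^+ (1 + 2 * (\dim {:K} - 1)) < `|q| ^+ D.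
  apply: exists_gt1_mul_expr_lt.
    apply: mulr_ge0; last by apply: prodr_ge0 => l _; apply: le_trans (be_ge1 l).
    by apply: mulr_ge0 (ltW al_gt0); rewrite exprn_ge0 // (le_trans ler01).
  by move: hineq; rewrite (eq_bigl _ _ i0E).
have de0 : 0 < de by apply: lt_trans de1.
pose w l := if l == i0 then de * al / `|q| ^+ D else (de * cd) * (de * be l).
have [N1 HN1] : exists N1, forall N, (N1 <= N)%N -> A N = 0.
  apply: (@integer_norm_eventually0 R K sigma g A w) => //.
  - move=> l; rewrite /w; case: eqP => _.
      by rewrite divr_ge0 ?mulr_ge0 // ltW.
    by rewrite !mulr_ge0 ?(ltW de0) ?(le_trans ler01).
  - rewrite (bigD1 i0) //= {1}/w eqxx mulrAC ltr_pdivrMr // mul1r.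
    apply: le_lt_trans hde.
    rewrite (eq_bigr (fun l => (de ^+ 2 * cd) * be l)); last first.
      by move=> l /negPf l0; rewrite /w l0; ring.
    rewrite big_split /= prodr_const.
    have -> : #|[pred l | l != i0]| = (\dim {:K} - 1)%N.
      by rewrite cardC1 card_ord subn1.
    rewrite exprMn exprD expr1 exprM.
    move: (\prod_(l | _) _) (_ ^+ (_ - 1)) (cd ^+ _) => x y z.
    by rewrite le_eqVlt; apply/orP; left; apply/eqP; ring.
  - move=> l; rewrite /w; case: eqP => [->|/eqP l0].
      have [B HB] : geometric_bound (fun n => sigma i0 (u n)) (de * al).
        apply: u_bound => // k; rewrite sigma0.
        exact: (le_bigmax 0 (fun k => `|iota (alpha k)|)).
      have [N0 HN0] : exists N0, forall N, (N0 <= N)%N ->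
          `|iota (A N)| <= 2 * B * (de * al) ^+ N.+1 / `|p N.+1|.
        apply: (@remainder_bound R p hPq p_large (fun N => iota (A N))
          (fun n => iota (u n)) _ _ _ _ iAS A_cvg); first exact: mulr_gt0.
        by move=> n; rewrite -(sigma0 (u n)).
      have B0 : 0 <= B.
        by have := le_trans (normc_ge0 _) (HB 0%N); rewrite expr0 mulr1.
      have [T HT] := p_lower.
      exists (2 * B / c0 * (de * al / `|q| ^+ D)), (maxn N0 T) => N.
      rewrite geq_max => /andP[NN0 NT]; rewrite sigma0.
      apply: le_trans (HN0 N NN0) _.
      have pN0 : 0 < `|p N.+1| by rewrite normr_gt0 hPq.
      have be0 : 0 < de * al by rewrite mulr_gt0.
      have q0 : 0 < `|q| by apply: lt_trans q1.
      apply: (@le_trans _ _ (2 * B * (de * al) ^+ N.+1 / (c0 * `|q| ^+ N.+1 ^+ D))).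
        rewrite ler_wpM2l ?mulr_ge0 ?exprn_ge0 ?(ltW be0) //.
        by rewrite lef_pV2 ?posrE ?mulr_gt0 ?exprn_gt0 // HT // leqW.
      rewrite -exprM [(_ * D)%N]mulnC exprM.
      move: (de * al) (`|q| ^+ D) qD_gt0 => x y y0.
      rewrite expr_div_n !exprS le_eqVlt; apply/orP; left; apply/eqP.
      by field; rewrite expf_neq0 ?gt_eqF.
    have [T HT] : exists T, forall t, (T <= t)%N ->
        Normc.normc (map_poly intr P).[sigma l g ^+ t] <= de * cd.
      apply: horner_power_small hP hdD cdnz _ de1.
      apply: (@PV_conjugate_lt1 R K iota); rewrite gq //.
      apply: contra l0 => /eqP lg; apply/eqP; apply: sinj.
      by apply: (rmorph_generator gK); rewrite lg s0 // gq.
    have [B HB] : geometric_bound (fun n => sigma l (u n)) (de * be l).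
      apply: u_bound => // k.
      exact: (le_bigmax 1 (fun k => Normc.normc (sigma l (alpha k)))).
    have [||N|N TN|C HC] := @perturbed_geometric_bound R
        (fun N => Normc.normc (sigma l (A N))) (de * cd) (de * be l) B T.
    - by rewrite mulr_ege1 // ltW.
    - by rewrite (lt_le_trans de1) // ler_peMr // ltW.
    - exact: normc_ge0.
    - rewrite AS rmorphD rmorphM (le_trans (le_normcD _ _)) // lerD //.
      rewrite Normc.normcM ler_wpM2r ?normc_ge0 // -horner_map rmorphXn /=.
      rewrite -map_poly_comp (eq_map_poly (g := intr)) ?HT ?leqW // => z /=.
      by rewrite rmorph_int.
    - by exists C, 0%N => N _; apply: HC.
have bk0 k j : bk k j = 0.
  apply: (@exponential_polynomial_eq0 _ _ _ N1.+1 alpha bk) => //.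
  - by move=> r; rewrite -(fmorph_pchar iota); apply: pchar_num.
  - move=> k1 k2 k12; apply/eqP; apply: contraT => /hunity[].
    exists 1%N => //; rewrite k12 divff //; apply/unity_rootP; exact: expr1n.
  - move=> [|n] // nN; rewrite -/(u n.+1); have := AS n.
    by rewrite HN1 ?(HN1 n) ?leqW // mulr0 add0r => <-.
case: i => [[k j]|]; first exact: bk0.
apply/eqP; rewrite -(fmorph_eq0 iota); apply/eqP; rewrite -[RHS]brel.
rewrite big1 ?addr0 // => k _; rewrite big1 // => j _.
by rewrite bk0 rmorph0 mul0r.
Qed.
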